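(* Let $\beta \ge 8$ be real. There is a constant $C=C(\beta)>0$, depending only on $\beta$, such that the following holds. Let $z, D$ be reals with $2\le z\le D^{1/(\beta+1)}$, let $\mathcal{P}$ be a set of primes, and let $P=P(z)=\prod_{p\in\mathcal{P},\,p<z}p$. Let $(\lambda_d)_{d\mid P}$ denote either the upper-bound or the lower-bound beta-sieve weights of level $D$ with parameter $\beta$. Then $$\sum_{d\mid P}\varphi(d)\Biggl(\sum_{\substack{m\mid P\\ m\equiv 0\ (\mathrm{mod}\ d)}}\frac{\lambda_m}{m}\Biggr)^2\le C\prod_{p\mid P}\Bigl(1-\frac1p\Bigr),$$ where $\varphi$ is Euler's totient function.
   Context: Sums over $d\mid P$, $m\mid P$ run over positive divisors of the squarefree integer $P$, and $\prod_{p\mid P}$ runs over the primes dividing $P$ (an empty product equals 1). Beta-sieve weights of level $D$ with parameter $\beta$: for a divisor $d$ of $P$ write $d=p_1p_2\cdots p_r$ with primes $p_1>p_2>\cdots>p_r$ ($r=0$ if $d=1$). Let $\mu$ be the Möbius function. - The upper-bound weights are $\lambda_d=\mu(d)$ if $p_1p_2\cdots p_m\,p_m^{\beta}<D$ for every odd $m$ with $1\le m\le r$, and $\lambda_d=0$ otherwise. - The lower-bound weights are $\lambda_d=\mu(d)$ if $p_1p_2\cdots p_m\,p_m^{\beta}<D$ for every even $m$ with $1\le m\le r$, and $\lambda_d=0$ otherwise. In particular $\lambda_1=1$ and $|\lambda_d|\le 1$. *)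

(* Defs.v *)
From HB Require Import structures.
From mathcomp Require Import all_boot all_order all_algebra.
From mathcomp Require Import boolp classical_sets reals exp.

Set Implicit Arguments.
Unset Strict Implicit.
Unset Printing Implicit Defensive.

Import Order.TTheory GRing.Theory Num.Theory.

Local Open Scope ring_scope.

Definition squarefree (n : nat) : bool :=
  (0 < n)%N && all (fun p => logn p n == 1%N) (primes n).

Definition mobius (n : nat) : int :=
  if squarefree n then (-1) ^+ size (primes n) else 0.

(* The a priori bound truncn z on p only serves to make the range finite: it is
   implied by p < z. *)
Definition sieve_prod (R : realType) (PP : set nat) (z : R) : nat :=
  (\prod_(0 <= p < (Num.truncn z).+1 | (p \in PP) && (p%:R < z)%R) p)%N.

Section BetaSieve.
Variables (R : realType) (beta D : R).

(* p_1 > ... > p_r: primes d is listed in increasing order. *)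
Definition primes_decr (d : nat) : seq nat := rev (primes d).

(* p_1 p_2 ... p_m p_m^beta < D; the sequence is indexed from 0, so that p_m is
   its entry m.-1. Only meaningful for 1 <= m <= r. *)
Definition beta_cond (d m : nat) : bool :=
  (\prod_(p <- take m (primes_decr d)) p)%N%:R
    * powR (nth 0%N (primes_decr d) m.-1)%:R beta < D.

Definition upper_beta_weight (d : nat) : R :=
  if all (fun m => odd m ==> beta_cond d m) (iota 1 (size (primes_decr d)))
  then (mobius d)%:~R else 0.

Definition lower_beta_weight (d : nat) : R :=
  if all (fun m => ~~ odd m ==> beta_cond d m) (iota 1 (size (primes_decr d)))
  then (mobius d)%:~R else 0.

End BetaSieve.

(* Main.v *)
Require Import Defs.
From HB Require Import structures.
From mathcomp Require Import all_boot all_order all_algebra.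
From mathcomp Require Import boolp classical_sets functions reals sequences exp.
From mathcomp Require Import ring lra zify.

Set Implicit Arguments.
Unset Strict Implicit.
Unset Printing Implicit Defensive.

Import Order.TTheory GRing.Theory Num.Theory.

Local Open Scope ring_scope.

(* Let Q(f, N) be the sum over d | N of phi(d) (sum_{d | m | N} f(m) / m)^2. It is
   the mean of (sum_{m | n} f(m))^2 when each prime p | N divides n independently
   with probability 1/p, so for a prime p not dividing N
     Q(f, pN) = (1 - 1/p) Q(f, N) + (1/p) Q(m |-> f(m) + f(pm), N).
   Peel off the primes of P in increasing order. If p is below all primes of m,
   then lambda(m) + lambda(pm) vanishes unless the sieve condition fails exactly
   at p, and in that case, with u = log z / log p, the earlier conditions force
   u <= (9/7)^((omega(m)+1)/2), hence u^5 <= 2^(omega(m)+1) as (9/7)^5 < 4.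
   So |lambda(m) + lambda(pm)| <= 2 u^(-5) 2^omega(m), and the second term of the
   recursion is at most (1/p) 4 u^(-10) prod_{p < q | P} (1 + 8/q). By Mertens'
   upper bound for sum 1/q the product is O(u^9 prod_{p <= q | P} (1 - 1/q)), and
   the recursion adds up to prod (1 - 1/q) times
   1 + O(sum_{p < z} 1/(p u)) = 1 + O(sum_{p < z} log p / (p log z)) = O(1). *)

(** * Chebyshev and Mertens bounds *)

Lemma prime_seq_prod_dvdn (s : seq nat) (N : nat) :
  uniq s -> {in s, forall p, prime p && (p %| N)%N} -> (\prod_(p <- s) p %| N)%N.
Proof.
elim: s => [|p s IH] /=; first by rewrite big_nil dvd1n.
case/andP=> ps us H; rewrite big_cons.
have /andP[pp pN] := H p (mem_head _ _).
rewrite Gauss_dvd ?pN ?IH //.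
  by move=> q qs; apply: H; rewrite inE qs orbT.
rewrite prime_coprime // Euclid_dvd_prod // big_has; apply/negP=> /hasP[q qs pq].
have /H/andP[qp _] : q \in p :: s by rewrite inE qs orbT.
by move: pq; rewrite dvdn_prime2 // => /eqP pq; rewrite pq qs in ps.
Qed.

(** The two equal middle coefficients both occur in the row sum 2^(2m+1) = 2 * 4^m. *)
Lemma central_bin_le (m : nat) : ('C(m.*2.+1, m) <= 4 ^ m)%N.
Proof.
have H : (\sum_(i < m.*2.+2) 'C(m.*2.+1, i) = 2 ^ m.*2.+1)%N.
  by rewrite -[2%N]/(1 + 1)%N expnDn; apply: eq_bigr => i _; rewrite !exp1n !muln1.
have hm : (m < m.*2.+2)%N by lia.
have hm1 : (m.+1 < m.*2.+2)%N by lia.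
move: H; rewrite (bigD1 (Ordinal hm)) //= (bigD1 (Ordinal hm1)) /=; last first.
  by rewrite -val_eqE /=; lia.
have -> : 'C(m.*2.+1, m.+1) = 'C(m.*2.+1, m).
  by rewrite -bin_sub; [congr 'C(_, _); lia | lia].
have -> : (2 ^ m.*2.+1 = 2 * 4 ^ m)%N by rewrite expnS -mul2n expnM.
lia.
Qed.

(** Erdős's induction. An even n > 2 adds no prime. For n = 2m + 1, the primes up to m + 1 are
    covered by the induction hypothesis; those above divide (2m+1)! but neither m! nor (m+1)!, hence
    divide the binomial coefficient, which is at most 4^m. *)
Lemma primorial_le (n : nat) :
  (\prod_(0 <= p < n.+1 | prime p) p <= 4 ^ n)%N.
Proof.
elim/ltn_ind: n => n IH.
case: n IH => [|[|[|n]]] IH.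
- by rewrite big_mkcond /= big_nat1.
- by rewrite big_mkcond /= !big_nat_recr //= big_geq.
- by rewrite big_mkcond /= !big_nat_recr //= big_geq.
have [on|en] := boolP (odd n.+3); last first.
  rewrite big_mkcond big_nat_recr //= -big_mkcond /=.
  have -> : prime n.+3 = false by apply: contraNF en => /even_prime[|->].
  rewrite muln1; apply: leq_trans (IH n.+2 _) _ => //.
  by rewrite leq_exp2l.
have [m nE] : exists m, n.+3 = m.*2.+1.
  by exists n.+3./2; rewrite -[LHS]odd_double_half on.
rewrite nE (@big_cat_nat _ _ _ m.+2) /=; [|lia|lia].
have h1 := IH m.+1 ltac:(lia).
have h2 : (\prod_(m.+2 <= p < m.*2.+2 | prime p) p <= 'C(m.*2.+1, m))%N.
  apply: dvdn_leq; first by rewrite bin_gt0; lia.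
  rewrite -big_filter; apply: prime_seq_prod_dvdn.
    by rewrite filter_uniq // iota_uniq.
  move=> p; rewrite mem_filter mem_index_iota => /andP[pp /andP[p1 p2]].
  rewrite pp /=.
  have := @bin_fact m.*2.+1 m ltac:(lia) => E.
  have : (p %| m.*2.+1 `!)%N by apply: dvdn_fact; lia.
  have nd k : (k < p)%N -> (p %| k`!)%N = false.
    move=> kp; rewrite fact_prod Euclid_dvd_prod // big_has.
    apply/negP=> /hasP[i]; rewrite mem_index_iota => /andP[i1 i2].
    move=> /dvdn_leq; lia.
  by rewrite -E !Euclid_dvdM // !nd ?orbF //; clear -p1; lia.
have := leq_mul h1 (leq_trans h2 (central_bin_le m)).
by rewrite -expnD; have -> : (m.+1 + m = m.*2.+1)%N by lia.
Qed.

Lemma fact_prod_primes (n : nat) :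
  n`! = (\prod_(0 <= p < n.+1 | prime p) p ^ logn p n`!)%N.
Proof.
have n0 := fact_gt0 n.
(* The factorization is widened to the range n! + n so that it can be cut at n; primes above n have
   exponent 0 in n!. *)
rewrite -[LHS]partnT // (@widen_partn (n`! + n)) ?leq_addr //.
rewrite (@big_cat_nat _ _ _ n.+1) //= ?ltnS ?leq_addl //.
rewrite [X in (_ * X)%N]big_nat_cond [X in (_ * X)%N]big1 ?muln1.
  rewrite [RHS]big_mkcond; apply: eq_bigr => p _.
  by case: ifP => // /negbT np; rewrite lognE (negbTE np).
move=> p /andP[/andP[np _] _].
have [pp|npp] := boolP (prime p); last by rewrite lognE (negbTE npp).
rewrite logn_fact // big_nat_cond big1 // => k /andP[/andP[k1 _] _].
apply: divn_small; apply: leq_trans np _.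
by rewrite -{1}[p]expn1 leq_exp2l // prime_gt1.
Qed.

Lemma ln_prod (R : realType) (I : eqType) (s : seq I) (P : pred I) (F : I -> R) :
  {in s, forall i, P i -> 0 < F i} ->
  ln (\prod_(i <- s | P i) F i) = \sum_(i <- s | P i) ln (F i).
Proof.
elim: s => [|i s IH] F0; first by rewrite !big_nil ln1.
have F0s : {in s, forall j, P j -> 0 < F j}.
  by move=> j js; apply: F0; rewrite inE js orbT.
rewrite !big_cons; case: ifP => Pi; last exact: IH.
rewrite lnM ?IH // posrE ?F0 ?mem_head //.
by rewrite big_seq_cond prodr_gt0 // => j /andP[/F0s]; apply.
Qed.

Lemma ln_sub_le (R : realType) (a b : R) : 0 < a -> 0 < b -> ln b - ln a <= b / a - 1.
Proof.
move=> a0 b0; rewrite -ln_div //.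
have := @le_ln1Dx R (b / a - 1); rewrite addrCA subrr addr0; apply.
have := divr_gt0 b0 a0; lra.
Qed.

Lemma ln_nat_ge0 (R : realType) (n : nat) : 0 <= ln (n%:R : R).
Proof. by case: n => [|n]; [rewrite ln0 | rewrite ln_ge0 // ler1n]. Qed.

Lemma ln_fact_primes (R : realType) (n : nat) :
  ln (n`!%:R : R) =
    \sum_(0 <= p < n.+1 | prime p) (logn p n`!)%:R * ln p%:R.
Proof.
rewrite [in LHS]fact_prod_primes natr_prod ln_prod => [|p _ pp]; last first.
  by rewrite ltr0n expn_gt0 prime_gt0.
apply: eq_bigr => p pp.
by rewrite natrX lnXn ?ltr0n ?prime_gt0 // mulr_natl.
Qed.

Lemma logn_fact_ge (p n : nat) : prime p -> (0 < n)%N -> (n %/ p <= logn p n`!)%N.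
Proof. by move=> pp n0; rewrite logn_fact // big_ltn // expn1 leq_addr. Qed.

Lemma logn_fact_le (p n : nat) : prime p -> (logn p n`! * p.-1 <= n)%N.
Proof.
move=> pp; rewrite logn_fact //.
have p0 := prime_gt0 pp.
(* Legendre's sum is compared with a geometric series: keeping the remainder [n %/ p ^ m] makes the
   bound inductive, since p * floor(n / p^(m+1)) <= floor(n / p^m). *)
suff H m : ((\sum_(1 <= k < m.+1) n %/ p ^ k) * p.-1 + n %/ p ^ m <= n)%N.
  by apply: leq_trans (H n); apply: leq_addr.
elim: m => [|m IH]; first by rewrite big_geq // mul0n expn0 divn1.
rewrite big_nat_recr //= mulnDl.
apply: leq_trans IH; rewrite -addnA leq_add2l.
rewrite -mulnSr prednK // expnSr divnMA; exact: leq_divM.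
Qed.

Lemma ln_fact_le (R : realType) (n : nat) : ln (n`!%:R : R) <= n%:R * ln n%:R.
Proof.
elim: n => [|n IH]; first by rewrite mul0r ln1.
rewrite factS natrM lnM ?posrE ?ltr0n ?fact_gt0 // [X in _ <= X * _]mulrS mulrDl mul1r.
rewrite lerD2l; apply: le_trans IH _; rewrite ler_wpM2l //.
case: n => [|n]; first by rewrite ln0 // ln1.
by rewrite ler_ln ?posrE ?ltr0n // ler_nat.
Qed.

Lemma ln_fact_ge (R : realType) (n : nat) :
  n%:R * ln n%:R - n%:R <= ln (n`!%:R : R).
Proof.
elim: n => [|n IH]; first by rewrite mul0r subrr ln1.
rewrite factS natrM lnM ?posrE ?ltr0n ?fact_gt0 //.
case: n IH => [|n] IH; first by rewrite !ln1; lra.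
have n0 : 0 < n.+1%:R :> R by rewrite ltr0n.
have := @ln_sub_le R n.+1%:R n.+2%:R n0 (ltr0Sn _ _).
rewrite -(ler_pM2l n0) mulrBr mulrBr mulr1 mulrCA mulfV ?gt_eqF // mulr1.
rewrite [n.+2%:R]mulrS; move: IH; set x := n.+1%:R; nra.
Qed.

(** The summand is the excess of ln p / (p - 1) over ln p / p, that is, the cost of the higher prime
    powers in Legendre's formula. *)
Lemma sum_primes_ln_quadratic_le (R : realType) (n : nat) :
  \sum_(0 <= p < n.+1 | prime p) (ln p%:R / (p%:R * (p%:R - 1)) : R) <= 2.
Proof.
case: n => [|n]; first by rewrite big_mkcond big_nat1.
(* [(ln k + 2) / k] is chosen so that its decrements dominate the terms. *)
suff : \sum_(0 <= p < n.+2 | prime p) (ln p%:R / (p%:R * (p%:R - 1)) : R)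
       <= 2 - (ln n.+1%:R + 2) / n.+1%:R.
  move/le_trans; apply; rewrite gerBl divr_ge0 // addr_ge0 //.
  exact: ln_nat_ge0.
elim: n => [|n IH].
  by rewrite big_mkcond /= !big_nat_recr //= big_geq // ln1; lra.
rewrite big_mkcond big_nat_recr //= -big_mkcond /=.
have n0 : 0 < n.+1%:R :> R by rewrite ltr0n.
have := @ln_sub_le R n.+1%:R n.+2%:R n0 (ltr0Sn _ _).
have := @ln_nat_ge0 R n.+2.
have n1 : 1 <= n.+1%:R :> R by rewrite ler1n.
move: IH; rewrite [n.+2%:R]mulrS.
move: n0 n1; move: (n.+1%:R : R) => x x0 x1 IH.
rewrite [1 + x - 1]addrC addKr => l0 H.
set S := (X in X + _ <= _); set t := (X in _ + X <= _).
have : t <= ln (1 + x) / ((1 + x) * x).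
  rewrite /t; case: ifP => // _; apply: divr_ge0 => //; nra.
have : ln (1 + x) / ((1 + x) * x) <= (ln x + 2) / x - (ln (1 + x) + 2) / (1 + x).
  have -> : (ln x + 2) / x - (ln (1 + x) + 2) / (1 + x) =
     ((ln x + 2) * (1 + x) - (ln (1 + x) + 2) * x) / ((1 + x) * x).
    by field; rewrite !gt_eqF //; lra.
  rewrite ler_pM2r ?invr_gt0 ?mulr_gt0 //; last lra.
  have : x * (ln (1 + x) - ln x) <= 1.
    by apply: le_trans (ler_wpM2l (ltW x0) H) _; rewrite mulrBr mulrCA mulfV ?gt_eqF //; lra.
  have : (ln (1 + x) - ln x) <= 1.
    apply: le_trans H _; rewrite mulrDl mulfV ?gt_eqF // mul1r.
    have := invf_le1 x0; rewrite x1; lra.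
  nra.
rewrite -/S in IH; lra.
Qed.

(** Mertens' first theorem, from ln n! <= n ln n: replacing n / p by the exponent of p in n! loses
    at most 1 per prime, in total the sum of ln p over p <= n, which the primorial bound makes at
    most n ln 4. *)
Lemma sum_primes_ln_div_le (R : realType) (n : nat) : (0 < n)%N ->
  \sum_(0 <= p < n.+1 | prime p) (ln p%:R / p%:R : R) <= ln n%:R + ln 4%:R.
Proof.
move=> n0; have n0' : 0 < n%:R :> R by rewrite ltr0n.
rewrite -(ler_pM2l n0') mulrDr.
have h1 := @ln_fact_le R n.
have h2 : \sum_(0 <= p < n.+1 | prime p) ln (p%:R : R) <= n%:R * ln 4%:R.
  rewrite -ln_prod => [|p _ pp]; last by rewrite ltr0n prime_gt0.
  rewrite mulr_natl -lnXn // -natrX -natr_prod ler_ln ?posrE ?ltr0n ?ler_nat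
    ?primorial_le ?expn_gt0 //.
  by rewrite prodn_cond_gt0 // => p /prime_gt0.
apply: le_trans (lerD h1 h2).
rewrite ln_fact_primes -big_split /= mulr_sumr; apply: ler_sum => p pp.
have -> : (logn p n`!)%:R * ln p%:R + ln p%:R = ln p%:R * ((logn p n`!)%:R + 1) :> R.
  by ring.
rewrite mulrCA; apply: ler_wpM2l; first exact: ln_nat_ge0.
rewrite ler_pdivrMr ?ltr0n ?prime_gt0 //.
rewrite natr1 -natrM ler_nat.
apply: leq_trans (ltnW (ltn_ceil n (prime_gt0 pp))) _.
by rewrite leq_mul2r ltnS logn_fact_ge // orbT.
Qed.

(** The exponent of p in n! is at most n / (p - 1). The constant 3 is 1 from ln n! >= n ln n - n
    plus 2 from the higher prime powers. *)
Lemma sum_primes_ln_div_ge (R : realType) (n : nat) : (0 < n)%N ->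
  ln n%:R - 3 <= \sum_(0 <= p < n.+1 | prime p) (ln p%:R / p%:R : R).
Proof.
move=> n0; have n0' : 0 < n%:R :> R by rewrite ltr0n.
have h1 := @ln_fact_ge R n.
have h2 := @sum_primes_ln_quadratic_le R n.
suff : ln (n`!%:R : R) <= n%:R * (\sum_(0 <= p < n.+1 | prime p) (ln p%:R / p%:R : R)
   + \sum_(0 <= p < n.+1 | prime p) (ln p%:R / (p%:R * (p%:R - 1)) : R)).
  move/(le_trans h1); rewrite -[X in _ - X]mulr1 -mulrBr ler_pM2l //; lra.
rewrite ln_fact_primes -big_split /= mulr_sumr; apply: ler_sum => p pp.
have p1 : 1 < p%:R :> R by rewrite ltr1n prime_gt1.
have -> : ln p%:R / p%:R + ln p%:R / (p%:R * (p%:R - 1)) = ln p%:R / (p%:R - 1) :> R.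
  by field; rewrite !gt_eqF //; lra.
rewrite mulrCA [X in X <= _]mulrC; apply: ler_wpM2l; first exact: ln_nat_ge0.
rewrite ler_pdivlMr; last lra.
have := logn_fact_le n pp.
by rewrite -(ler_nat R) natrM -subn1 natrB // prime_gt0.
Qed.

(* Abel summation; the remainder is controlled by
   [1 - x / y <= ln y - ln x] with [x = ln n], [y = ln (n + 1)]. *)
Lemma sum_div_ln_le (R : realType) (a : nat -> R) (w : nat) (C : R) : (1 < w)%N ->
  (forall n, (w <= n)%N -> \sum_(w <= k < n.+1) a k <= ln n%:R - ln w%:R + C) ->
  forall n, (w <= n)%N ->
    \sum_(w <= k < n.+1) a k / ln k%:R <= ln (ln n%:R) - ln (ln w%:R) + C / ln w%:R.
Proof.
move=> w1 aC n wn.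
have lngt0 k : (w <= k)%N -> 0 < ln (k%:R : R).
  by move=> wk; rewrite ln_gt0 // ltr1n (leq_trans w1).
have lw0 := lngt0 w (leqnn w).
(* With A(n) / ln n subtracted, A(n) being the partial sum of [a], the left side grows from n to n +
   1 by exactly A(n) (1 / ln n - 1 / ln (n + 1)), to which the hypothesis applies. *)
suff H : \sum_(w <= k < n.+1) a k / ln k%:R - (\sum_(w <= k < n.+1) a k) / ln n%:R
    <= ln (ln n%:R) - ln (ln w%:R) + (C - ln w%:R) * ((ln w%:R)^-1 - (ln n%:R)^-1).
  have ln0 := lngt0 n wn.
  have H1 : (\sum_(w <= k < n.+1) a k) / ln n%:R <= (ln n%:R - ln w%:R + C) / ln n%:R.
    by rewrite ler_pM2r ?invr_gt0 ?aC.
  have : (ln n%:R - ln w%:R + C) / ln n%:R + (C - ln w%:R) * ((ln w%:R)^-1 - (ln n%:R)^-1)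
      = C / ln w%:R by field; rewrite !gt_eqF.
  lra.
elim: n wn => [|n IH]; first by case: (w) w1.
rewrite leq_eqVlt => /orP[/eqP <-|].
  by rewrite !big_nat1 !subrr mulr0 addr0.
rewrite ltnS => wn; have {IH} := IH wn.
rewrite ![\sum_(w <= k < n.+2) _]big_nat_recr ?leqW //=.
have := aC n wn.
have l0 := lngt0 n wn; have l0' := lngt0 n.+1 (leqW wn).
have l01 : ln n%:R <= ln n.+1%:R :> R.
  by rewrite ler_ln ?posrE ?ltr0n ?ler_nat //; lia.
have := ln_sub_le l0' l0.
set S := \sum_(w <= k < n.+1) a k; set T := \sum_(w <= k < n.+1) _.
move: l0 l0' l01 lw0; set x := ln n%:R; set y := ln n.+1%:R; set v := ln w%:R.
move=> x0 y0 xy v0 H1 H2 H3.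
have : S * (x^-1 - y^-1) <= (x - v + C) * (x^-1 - y^-1).
  by apply: ler_wpM2r => //; rewrite subr_ge0 lef_pV2.
have : (x - v + C) * (x^-1 - y^-1) = 1 - x / y + (C - v) * (x^-1 - y^-1).
  by field; rewrite !gt_eqF.
lra.
Qed.

Lemma ln2_bounds (R : realType) : 2^-1 <= ln (2 : R) <= 1.
Proof.
have := @ln_sub_le R 1 2 ltr01 (ltr0Sn R 1).
have := @ln_sub_le R 2 1 (ltr0Sn R 1) ltr01; rewrite ln1; lra.
Qed.

(** Abel summation applied to ln p / p. Its constant is 3 ln 2 + 3: ln 4 from the upper bound at n,
    3 from the lower bound at w - 1, and ln 2 for passing from ln (w - 1) to ln w. Divided by ln w
    >= ln 2 >= 1/2 it is at most 9. *)
Lemma sum_primes_inv_le (R : realType) (w n : nat) : (1 < w)%N -> (w <= n)%N ->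
  \sum_(w <= p < n.+1 | prime p) (p%:R^-1 : R) <= ln (ln n%:R) - ln (ln w%:R) + 9.
Proof.
move=> w1 wn; have /andP[l2 l2'] := @ln2_bounds R.
have ln2w : ln 2 <= ln w%:R :> R by rewrite ler_ln ?posrE ?ltr0n ?ler_nat //; lia.
have l4 : ln 4%:R = 2 * ln 2 :> R.
  by rewrite (_ : 4%:R = 2 ^+ 2) ?lnXn // ?mulr_natl // -natrX.
have H m : (w <= m)%N ->
    \sum_(w <= k < m.+1) (if prime k then ln k%:R / k%:R else 0 : R)
      <= ln m%:R - ln w%:R + (3 * ln 2 + 3).
  move=> wm; rewrite -big_mkcond /=.
  have := @sum_primes_ln_div_le R m ltac:(lia).
  have := @sum_primes_ln_div_ge R w.-1 ltac:(lia).
  rewrite (@big_cat_nat _ _ _ w 0 m.+1) //=; last lia.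
  rewrite prednK ?(ltnW w1) // l4.
  have : ln w%:R <= ln w.-1%:R + ln 2 :> R.
    rewrite -lnM ?posrE ?ltr0n //; last lia.
    rewrite -natrM ler_ln ?posrE ?ltr0n ?ler_nat //; lia.
  lra.
have H1 := sum_div_ln_le w1 H wn.
rewrite big_mkcond /=.
have -> : \sum_(w <= p < n.+1) (if prime p then p%:R^-1 else 0 : R) =
  \sum_(w <= k < n.+1) (if prime k then ln k%:R / k%:R else 0) / ln k%:R.
  apply: eq_bigr => p _; case: ifP => [pp|_]; last by rewrite mul0r.
  rewrite mulrAC mulfV ?mul1r // gt_eqF // ln_gt0 // ltr1n prime_gt1 //.
apply: le_trans H1 _; rewrite lerD2l ler_pdivrMr; lra.
Qed.

Lemma ler_sum_prime_seq (R : numDomainType) (s : seq nat) (w n : nat) (F : nat -> R) :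
  uniq s -> {in s, forall p, prime p && (w <= p <= n)%N} -> (forall p, 0 <= F p) ->
  \sum_(p <- s) F p <= \sum_(w <= p < n.+1 | prime p) F p.
Proof.
move=> us sp F0.
rewrite (perm_big (filter (mem s) (filter prime (index_iota w n.+1)))) /=; last first.
  apply: uniq_perm; rewrite ?filter_uniq ?iota_uniq // => p.
  rewrite !mem_filter mem_index_iota ltnS /=.
  by apply/idP/andP => [ps|[]//]; rewrite ps; split=> //; apply: sp.
rewrite big_filter -[in leRHS]big_filter [leLHS]big_mkcond.
by apply: ler_sum => p _; case: ifP.
Qed.

(** Factor by factor, (1 + 8/q) / (1 - 1/q) <= exp (9/q + 1/(q (q - 1))); the 9 becomes the exponent
    of ln z / ln w through Mertens' bound. *)
Lemma prod_primes_ratio_le (R : realType) (s : seq nat) (w : nat) (z : R) :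
  (1 < w)%N -> w%:R < z -> uniq s ->
  {in s, forall q, [&& prime q, (w <= q)%N & q%:R < z]} ->
  \prod_(q <- s) (1 + 8 / q%:R) <=
    expR 85 * (ln z / ln w%:R) ^+ 9 * \prod_(q <- s) (1 - q%:R^-1).
Proof.
move=> w1 wz us sp.
have w0 : 0 < w%:R :> R by rewrite ltr0n ltnW.
have z0 := lt_trans w0 wz.
have lw0 : 0 < ln (w%:R : R) by rewrite ln_gt0 // ltr1n.
have lz0 : 0 < ln z by rewrite (lt_trans lw0) // ltr_ln ?posrE.
set n := Num.truncn z.
have nz : n%:R <= z by have /andP[] := truncn_itv (ltW z0).
have wn : (w <= n)%N by rewrite truncn_ge_nat ?ltW.
have spn : {in s, forall q, prime q && (w <= q <= n)%N}.
  by move=> q /sp/and3P[-> -> qz]; rewrite truncn_ge_nat ?ltW.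
have F1 (p : nat) : 0 <= (p%:R : R)^-1 by rewrite invr_ge0.
have F2 (p : nat) : 0 <= ln p%:R / (p%:R * (p%:R - 1)) :> R.
  case: p => [|p]; first by rewrite ln0 // mul0r.
  by rewrite divr_ge0 ?ln_nat_ge0 // mulr_ge0 // subr_ge0 ler1n.
have S1 := le_trans (ler_sum_prime_seq us spn F1) (sum_primes_inv_le R w1 wn).
have S2 : \sum_(q <- s) (ln q%:R / (q%:R * (q%:R - 1)) : R) <= 2.
  apply: le_trans (@sum_primes_ln_quadratic_le R n).
  by apply: ler_sum_prime_seq => // q qs; have /andP[-> /andP[]] := spn q qs.
have llnz : ln (ln n%:R) <= ln (ln z).
  have n0 : 0 < n%:R :> R by rewrite ltr0n; lia.
  rewrite ler_ln ?posrE //; first by rewrite ler_ln ?posrE.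
  by rewrite ln_gt0 // ltr1n; lia.
(* 85 = 9 * 9 + 2 * 2: nine times the constant in the sum of 1/q, and twice the bound on the
   quadratic sum. *)
have {S1 S2 llnz} S : \sum_(q <- s) (9 / q%:R + 2 * (ln q%:R / (q%:R * (q%:R - 1)))) <=
   85 + (ln (ln z) - ln (ln w%:R)) *+ 9.
  rewrite big_split -!mulr_sumr /=; lra.
have -> : expR 85 * (ln z / ln w%:R) ^+ 9 = expR (85 + (ln (ln z) - ln (ln w%:R)) *+ 9).
  by rewrite (expRD 85) -(mulr_natl _ 9) expRM_natl -ln_div ?posrE // lnK // posrE divr_gt0.
apply: (@le_trans _ _ (expR (\sum_(q <- s) (9 / q%:R + 2 * (ln q%:R / (q%:R * (q%:R - 1)))))
    * \prod_(q <- s) (1 - q%:R^-1))); last first.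
  rewrite ler_wpM2r ?ler_expR // big_seq prodr_ge0 // => q /sp/andP[pq _].
  by rewrite subr_ge0 invf_le1 ?ltr0n ?prime_gt0 // ler1n prime_gt0.
rewrite expR_sum -big_split /= big_seq [leRHS]big_seq; apply: ler_prod => q /sp/andP[pq _].
have q0 : 0 < (q%:R : R) by rewrite ltr0n prime_gt0.
have q2 : 2 <= (q%:R : R) by rewrite ler_nat prime_gt1.
rewrite addr_ge0 ?divr_ge0 //=.
have qi : q%:R^-1 < 1 :> R by rewrite invf_lt1 //; lra.
rewrite -ler_pdivrMr ?subr_gt0 //.
have l2 : 2^-1 <= ln (q%:R : R).
  have /andP[l _] := @ln2_bounds R; apply: le_trans l _.
  by rewrite ler_ln ?posrE.
have E1 : 1 + 8 / q%:R <= expR (8 / q%:R) :> R by exact: expR_ge1Dx.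
have E2 : (1 - q%:R^-1)^-1 <= expR (1 / q%:R + 1 / (q%:R * (q%:R - 1))) :> R.
  apply: le_trans (expR_ge1Dx _).
  by rewrite le_eqVlt; apply/orP; left; apply/eqP; field; rewrite !gt_eqF //; lra.
apply: le_trans (ler_pM _ _ E1 E2) _.
- by rewrite addr_ge0 ?divr_ge0.
- by rewrite invr_ge0 subr_ge0 ltW.
rewrite -expRD ler_expR.
(* The factor 2 ln q >= 1 is inserted to reuse the bound on the sum of ln q / (q (q - 1)). *)
have : 1 / (q%:R * (q%:R - 1)) <= 2 * (ln q%:R / (q%:R * (q%:R - 1))) :> R.
  rewrite mulrA ler_pM2r; first lra.
  by rewrite invr_gt0 mulr_gt0 //; lra.
lra.
Qed.

Lemma sum_primes_ln_div_seq_le (R : realType) (s : seq nat) (z : R) :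
  2 <= z -> uniq s -> {in s, forall q, prime q && (q%:R < z)} ->
  \sum_(q <- s) (ln q%:R / q%:R) <= 3 * ln z.
Proof.
move=> z2 us sp; have z0 : 0 < z by lra.
set n := Num.truncn z.
have nz : n%:R <= z by have /andP[] := truncn_itv (ltW z0).
have n0 : (0 < n)%N by rewrite truncn_gt0; lra.
have spn : {in s, forall q, prime q && (0 <= q <= n)%N}.
  by move=> q /sp/andP[-> qz]; rewrite truncn_ge_nat ?ltW.
have F0 (p : nat) : 0 <= ln p%:R / (p%:R : R) by rewrite divr_ge0 ?ln_nat_ge0.
apply: le_trans (ler_sum_prime_seq us spn F0) _.
apply: le_trans (sum_primes_ln_div_le R n0) _.
have l4 : ln 4%:R = 2 * ln 2 :> R.
  by rewrite (_ : 4%:R = 2 ^+ 2) ?lnXn // ?mulr_natl // -natrX.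
have : ln n%:R <= ln z by rewrite ler_ln ?posrE ?ltr0n.
have : ln 2 <= ln z by rewrite ler_ln ?posrE.
lra.
Qed.

(** * Prime lists and divisors of squarefree products *)

Lemma primes_primeM_lt (p m : nat) : prime p -> (0 < m)%N ->
  {in primes m, forall q, (p < q)%N} -> primes (p * m) = p :: primes m.
Proof.
move=> pp m0 pm; apply: (irr_sorted_eq ltn_trans ltnn (sorted_primes _)).
  rewrite /= path_sortedE; last exact: ltn_trans.
  by rewrite sorted_primes andbT; apply/allP.
by move=> q; rewrite primesM // ?prime_gt0 // primes_prime // !inE.
Qed.

Lemma prod_prime_seq_gt0 (s : seq nat) : all prime s -> (0 < \prod_(p <- s) p)%N.
Proof. by move=> sp; rewrite big_seq prodn_cond_gt0 // => q /(allP sp)/prime_gt0. Qed.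

Lemma primes_prod_sorted (s : seq nat) :
  sorted ltn s -> all prime s -> primes (\prod_(p <- s) p) = s.
Proof.
elim: s => [|p s IH]; first by rewrite big_nil.
rewrite /= path_sortedE; last exact: ltn_trans.
case/andP=> ps ss /andP[pp sp].
have {}IH := IH ss sp.
rewrite big_cons primes_primeM_lt ?IH //; last exact/allP.
exact: prod_prime_seq_gt0.
Qed.

Lemma big_divisors_primeM (V : nmodType) (p N : nat) (F : nat -> V) :
  prime p -> (0 < N)%N -> ~~ (p %| N)%N ->
  \sum_(d <- divisors (p * N)) F d = \sum_(d <- divisors N) (F d + F (p * d)%N).
Proof.
move=> pp N0 pN; have p0 := prime_gt0 pp.
rewrite big_split /= -(big_map (muln p) predT) -big_cat.
apply: perm_big; apply: uniq_perm; first exact: divisors_uniq.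
  rewrite cat_uniq divisors_uniq map_inj_uniq ?divisors_uniq ?andbT /=; last first.
    by move=> x y /eqP; rewrite eqn_pmul2l // => /eqP.
  apply/hasPn => _ /mapP[d _ ->]; rewrite -dvdn_divisors //.
  by apply: contra pN; apply: dvdn_trans; rewrite dvdn_mulr.
move=> d; rewrite mem_cat -!dvdn_divisors ?muln_gt0 ?p0 //.
apply/idP/orP => [dpN|[dN|/mapP[e eN ->]]].
- have [pd|pd] := boolP (p %| d)%N; last first.
    by left; move: dpN; rewrite Gauss_dvdr // coprime_sym prime_coprime.
  right; apply/mapP; exists (d %/ p)%N; last by rewrite mulnC divnK.
  rewrite -dvdn_divisors // -(@dvdn_pmul2l p) // mulnC divnK //.
- exact: dvdn_mull.
- by rewrite dvdn_pmul2l // dvdn_divisors.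
Qed.

(** * The sieve quadratic form *)

Definition sieve_form (R : realType) (f : nat -> R) (N : nat) : R :=
  \sum_(d <- divisors N)
    (totient d)%:R * (\sum_(m <- divisors N | (d %| m)%N) f m / m%:R) ^+ 2.

(** With S and G the sums of f(m)/m and f(pm)/m over d | m | N, the divisors d and pd of pN together
    contribute phi(d) ((S + G/p)^2 + (p - 1) (G/p)^2), which equals phi(d) ((1 - 1/p) S^2 + (1/p) (S
    + G)^2). *)
Lemma sieve_form_primeM (R : realType) (f : nat -> R) (p N : nat) :
  prime p -> (0 < N)%N -> ~~ (p %| N)%N ->
  sieve_form f (p * N) = (1 - p%:R^-1) * sieve_form f N
    + p%:R^-1 * sieve_form (fun m => f m + f (p * m)%N) N.
Proof.
move=> pp N0 pN; rewrite {1}/sieve_form big_divisors_primeM // /sieve_form.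
rewrite !mulr_sumr -big_split /=.
rewrite big_seq [RHS]big_seq; apply: eq_bigr => d; rewrite -dvdn_divisors // => dN.
have p0 : p%:R != 0 :> R by rewrite pnatr_eq0 -lt0n prime_gt0.
have pd : coprime p d.
  by rewrite prime_coprime //; apply: contra pN => /dvdn_trans; apply.
set S := \sum_(m <- divisors N | (d %| m)%N) f m / m%:R.
set G := \sum_(m <- divisors N | (d %| m)%N) f (p * m)%N / m%:R.
have -> : \sum_(m <- divisors N | (d %| m)%N) (f m + f (p * m)%N) / m%:R = S + G.
  by rewrite -big_split; apply: eq_bigr => m _; rewrite mulrDl.
have natpM m : f (p * m)%N / (p * m)%:R = p%:R^-1 * (f (p * m)%N / m%:R).
  by rewrite natrM invfM; ring.
have -> : \sum_(m <- divisors (p * N) | (d %| m)%N) f m / m%:R = S + p%:R^-1 * G.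
  rewrite big_mkcond big_divisors_primeM // big_split /= -big_mkcond; congr (_ + _).
  rewrite /G big_mkcond mulr_sumr [RHS]big_mkcond; apply: eq_bigr => m _ /=.
  rewrite Gauss_dvdr 1?coprime_sym // natpM.
  by case: ifP => // _; rewrite mulr0.
have -> : \sum_(m <- divisors (p * N) | (p * d %| m)%N) f m / m%:R = p%:R^-1 * G.
  rewrite big_mkcond big_divisors_primeM // big_split /= big1_seq ?add0r; last first.
    move=> m /andP[_]; rewrite -dvdn_divisors // => mN; case: ifP => // pdm.
    case/negP: pN; apply: dvdn_trans mN; apply: dvdn_trans pdm; exact: dvdn_mulr.
  rewrite /G mulr_sumr [RHS]big_mkcond; apply: eq_bigr => m _ /=.
  by rewrite dvdn_pmul2l ?prime_gt0 // natpM.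
rewrite totient_coprime // (totient_prime pp) natrM -subn1 natrB ?prime_gt0 //.
by field.
Qed.

Lemma sieve_form1 (R : realType) (f : nat -> R) : sieve_form f 1 = f 1%N ^+ 2.
Proof.
rewrite /sieve_form (_ : divisors 1 = [:: 1%N]) // big_seq1 big_mkcond big_seq1 /=.
by rewrite divr1 (_ : totient 1 = 1%N) // mul1r.
Qed.

Lemma le_sieve_form (R : realType) (f h : nat -> R) (N : nat) : (0 < N)%N ->
  (forall m, (m %| N)%N -> `|f m| <= h m) -> sieve_form f N <= sieve_form h N.
Proof.
move=> N0 fh; apply: ler_sum => d _; apply: ler_wpM2l => //.
rewrite -[leLHS]real_normK ?num_real // ler_pXn2r ?nnegrE //.
- rewrite big_seq_cond [leRHS]big_seq_cond.
  apply: le_trans (ler_norm_sum _ _ _) _; apply: ler_sum => m /andP[].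
  rewrite -dvdn_divisors // => mN _.
  rewrite normrM normfV normr_nat; apply: ler_wpM2r; rewrite ?invr_ge0 ?fh //.
- rewrite big_seq_cond sumr_ge0 // => m /andP[]; rewrite -dvdn_divisors // => mN _.
  by rewrite divr_ge0 // (le_trans _ (fh m mN)).
Qed.

Lemma eq_sieve_form (R : realType) (f h : nat -> R) (N : nat) : (0 < N)%N ->
  (forall m, (m %| N)%N -> f m = h m) -> sieve_form f N = sieve_form h N.
Proof.
move=> N0 fh; apply: eq_bigr => d _; congr (_ * _ ^+ 2).
rewrite big_seq_cond [RHS]big_seq_cond; apply: eq_bigr => m /andP[].
by rewrite -dvdn_divisors // => mN _; rewrite fh.
Qed.

Lemma primes_dvd_prod_sorted (s : seq nat) (m : nat) :
  sorted ltn s -> all prime s -> (m %| \prod_(p <- s) p)%N -> {subset primes m <= s}.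
Proof.
move=> ss sp ms q; rewrite -[in X in _ -> X](primes_prod_sorted ss sp) !mem_primes.
by case/and3P=> -> _ qm; rewrite prod_prime_seq_gt0 // (dvdn_trans qm).
Qed.

(** For f(m) = c 2^omega(m) one has f(m) + f(pm) = 3 f(m), so the recursion multiplies the form by
    (1 - 1/p) + 9/p = 1 + 8/p. *)
Lemma sieve_form_exp_omega (R : realType) (s : seq nat) (c : R) :
  sorted ltn s -> all prime s ->
  sieve_form (fun m => c * 2 ^+ size (primes m)) (\prod_(p <- s) p)%N
    = c ^+ 2 * \prod_(q <- s) (1 + 8 / q%:R).
Proof.
elim: s c => [|p s IH] c.
  by rewrite !big_nil sieve_form1 expr0 !mulr1.
move=> pss /[dup] psp /andP[pp sp].
have ss := path_sorted pss.
have /allP ps : all (ltn p) s.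
  by move: pss; rewrite /= path_sortedE //; [case/andP|exact: ltn_trans].
have N0 := prod_prime_seq_gt0 sp.
rewrite !big_cons sieve_form_primeM //; last first.
  apply/negP => pN; have : p \in primes (\prod_(q <- s) q)%N by rewrite mem_primes pp N0.
  by rewrite primes_prod_sorted // => /ps /=; rewrite ltnn.
rewrite (@eq_sieve_form _ (fun m => _ + _) (fun m => (c * 3) * 2 ^+ size (primes m))) //.
  by rewrite !IH //; ring.
move=> m mN; rewrite primes_primeM_lt ?(dvdn_gt0 _ mN) //=.
  by rewrite exprS; ring.
by move=> q /(primes_dvd_prod_sorted ss sp mN)/ps.
Qed.

(** * Beta-sieve weights *)

Lemma mobius_primeM_lt (p m : nat) : prime p -> (0 < m)%N ->
  {in primes m, forall q, (p < q)%N} -> mobius (p * m) = - mobius m.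
Proof.
move=> pp m0 pm; rewrite /mobius /squarefree primes_primeM_lt // muln_gt0 prime_gt0 // m0 /=.
rewrite lognM // ?prime_gt0 // logn_prime // eqxx.
have -> : logn p m = 0%N.
  have [pm'|/negPf pm'] := boolP (p %| m)%N; last by rewrite lognE pm' !andbF.
  have /pm : p \in primes m by rewrite mem_primes pp m0.
  by rewrite ltnn.
rewrite /= (@eq_in_all _ _ (fun q => logn q m == 1%N)) => [|q qm].
  by case: ifP => _; rewrite ?oppr0 // exprS mulN1r.
rewrite lognM // ?prime_gt0 // logn_prime //.
by have /pm/gtn_eqF-> := qm.
Qed.

Lemma norm_mobius_le1 (R : realType) (d : nat) : `|(mobius d)%:~R : R| <= 1.
Proof.
rewrite /mobius; case: ifP => _; last by rewrite normr0.
by rewrite rmorphXn rmorphN1 normrX normrN1 expr1n.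
Qed.

(* [b] is the parity of the tested indices: true (odd) for the upper-bound
   weights, false (even) for the lower-bound ones. *)
Definition beta_weight (R : realType) (b : bool) (beta D : R) (d : nat) : R :=
  if all (fun m => (odd m == b) ==> beta_cond beta D d m) (iota 1 (size (primes_decr d)))
  then (mobius d)%:~R else 0.

Lemma upper_beta_weightE (R : realType) (beta D : R) :
  upper_beta_weight beta D = beta_weight true beta D.
Proof.
apply/funext => d; rewrite /upper_beta_weight /beta_weight.
by under [in RHS]eq_all do rewrite eqb_id.
Qed.

Lemma lower_beta_weightE (R : realType) (beta D : R) :
  lower_beta_weight beta D = beta_weight false beta D.
Proof.
apply/funext => d; rewrite /lower_beta_weight /beta_weight.
by under [in RHS]eq_all do rewrite eqbF_neg.
Qed.

(* [t] is the increasing list of primes of a divisor d, so that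
   [beta_cond beta D d] is [seq_beta_cond beta D (primes d)] by conversion. *)
Definition seq_beta_cond (R : realType) (beta D : R) (t : seq nat) (m : nat) : bool :=
  (\prod_(p <- take m (rev t)) p)%N%:R * powR (nth 0%N (rev t) m.-1)%:R beta < D.

(** A new smallest prime comes last in the decreasing order, so the earlier conditions do not see
    it. *)
Lemma seq_beta_cond_cons (R : realType) (beta D : R) (q : nat) (t : seq nat) (m : nat) :
  (0 < m <= size t)%N -> seq_beta_cond beta D (q :: t) m = seq_beta_cond beta D t m.
Proof.
case/andP=> m0 mt; rewrite /seq_beta_cond rev_cons -cats1 takel_cat ?size_rev //.
by rewrite nth_cat size_rev prednK // mt.
Qed.

Lemma seq_beta_cond_last (R : realType) (beta D : R) (q : nat) (t : seq nat) :
  0 < D -> {in q :: t, forall p, (0 < p)%N} ->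
  seq_beta_cond beta D (q :: t) (size t).+1 =
    (\sum_(p <- q :: t) ln p%:R + beta * ln q%:R < ln D).
Proof.
move=> D0 t0; rewrite /seq_beta_cond take_oversize ?size_rev //=.
rewrite (perm_big _ (permEl (perm_rev _))) /=.
rewrite nth_rev //= subnn /= natr_prod.
have q0 : 0 < powR (q%:R : R) beta by rewrite powR_gt0 // ltr0n t0 ?mem_head.
have P0 : 0 < \prod_(p <- q :: t) (p%:R : R).
  by rewrite big_seq prodr_gt0 // => p /t0; rewrite ltr0n.
rewrite -ltr_ln ?posrE ?mulr_gt0 // lnM ?posrE // ln_powR ln_prod // => p /t0.
by rewrite ltr0n.
Qed.

Lemma all_seq_beta_cond_cons (R : realType) (b : bool) (beta D : R) (q : nat) (t : seq nat) :
  all (fun m => (odd m == b) ==> seq_beta_cond beta D (q :: t) m) (iota 1 (size t).+1) =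
  all (fun m => (odd m == b) ==> seq_beta_cond beta D t m) (iota 1 (size t)) &&
  ((odd (size t).+1 == b) ==> seq_beta_cond beta D (q :: t) (size t).+1).
Proof.
have -> : iota 1 (size t).+1 = iota 1 (size t) ++ [:: (size t).+1].
  by have := iotaD 1 (size t) 1; rewrite addn1 add1n.
rewrite all_cat all_seq1.
congr (_ && _); apply: eq_in_all => m; rewrite mem_iota add1n ltnS => mt.
by rewrite seq_beta_cond_cons.
Qed.

(* Two consecutive primes q1 < q2 of t use up at most 2 log q2 of the remaining
   log (D / prod t), which exceeds (beta + 1) log q2 by the condition at q2; hence
   the factor 1 - 2 / (beta + 1) >= 7/9 for every two primes. *)
Lemma seq_beta_cond_lower_bound (R : realType) (b : bool) (beta D z : R) (t : seq nat) :
  8 <= beta -> 0 < D -> 0 < ln z -> (beta + 1) * ln z <= ln D ->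
  sorted ltn t -> {in t, forall q, (0 < q)%N && (q%:R < z)} ->
  all (fun m => (odd m == b) ==> seq_beta_cond beta D t m) (iota 1 (size t)) ->
  odd (size t).+1 = b ->
  (7 / 9) ^+ uphalf (size t) * ln D <= ln D - \sum_(q <- t) ln q%:R.
Proof.
move=> b8 D0 lz0 zD.
have [n] := ubnP (size t); elim: n t => // n IH [|q1 [|q2 t]] tn st tz ct ot.
- by rewrite big_nil subr0 mul1r.
(* With one prime the parity leaves no condition to test; q1 < z alone gives ln q1 <= ln D / 9. *)
- have /andP[q0 qz] := tz q1 (mem_head _ _).
  have : ln q1%:R <= ln z.
    by rewrite ler_ln ?posrE ?ltr0n ?ltW // (lt_trans _ qz) // ltr0n.
  rewrite big_seq1 /= expr1; nra.
have q12 : (q1 < q2)%N by case/andP: st.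
have tz' : {in q2 :: t, forall q, (0 < q)%N && (q%:R < z)}.
  by move=> q qt; apply: tz; rewrite inE qt orbT.
move: ct; rewrite [size _]/= all_seq_beta_cond_cons => /andP[+ _].
rewrite [size _]/= all_seq_beta_cond_cons => /andP[ct].
(* The index of q2 has the tested parity, while that of q1 has not. *)
have ot' : odd (size t).+1 = b by rewrite -ot /= negbK.
rewrite ot' eqxx seq_beta_cond_last // => [c2|q /tz' /andP[] //].
have {IH ct tz' ot'} := IH t (ltnW tn) _ _ ct ot'.
have q20 : (0 < q2)%N by apply: leq_ltn_trans q12.
have : ln q1%:R <= ln q2%:R :> R.
  have /andP[q10 _] := tz q1 (mem_head _ _).
  by rewrite ler_ln ?posrE ?ltr0n // ler_nat ltnW.
have := ln_nat_ge0 R q2.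
move: c2; rewrite !big_cons; set S := \sum_(j <- t) _.
rewrite [uphalf _]/= exprS => c2 l2 l12 H.
have {}H : (7 / 9) ^+ uphalf (size t) * ln D <= ln D - S.
  apply: H; first by case/andP: st => _; exact: path_sorted.
  by move=> q qt; apply: tz; rewrite !inE qt !orbT.
have : 8 * ln q2%:R <= beta * ln q2%:R by rewrite ler_wpM2r.
lra.
Qed.

(** Failure at p says ln D - sum ln q <= (beta + 1) ln p. Against the lower bound (7/9)^k ln D for
    the left side, and ln D >= (beta + 1) ln z, this gives ln z / ln p <= (9/7)^k, whose fifth power
    is at most 4^k. *)
Lemma seq_beta_cond_failure (R : realType) (b : bool) (beta D z : R) (p : nat) (t : seq nat) :
  8 <= beta -> 0 < D -> 0 < ln z -> (beta + 1) * ln z <= ln D ->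
  sorted ltn (p :: t) -> (1 < p)%N -> {in p :: t, forall q, (0 < q)%N && (q%:R < z)} ->
  all (fun m => (odd m == b) ==> seq_beta_cond beta D t m) (iota 1 (size t)) ->
  odd (size t).+1 = b -> ~~ seq_beta_cond beta D (p :: t) (size t).+1 ->
  (ln z / ln p%:R) ^+ 5 <= 2 ^+ (size t).+1.
Proof.
move=> b8 D0 lz0 zD st p1 tz ct ot.
rewrite seq_beta_cond_last // => [|q /tz/andP[]//]; rewrite -leNgt big_cons => H1.
have H2 := @seq_beta_cond_lower_bound R b beta D z t b8 D0 lz0 zD (path_sorted st)
  ltac:(by move=> q qt; apply: tz; rewrite inE qt orbT) ct ot.
have lp0 : 0 < ln (p%:R : R) by rewrite ln_gt0 // ltr1n.
set k := uphalf (size t) in H2.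
have r0 : 0 < (7 / 9 : R) ^+ k by rewrite exprn_gt0 //; lra.
have u1 : (7 / 9) ^+ k * ln z <= ln p%:R.
  rewrite -(@ler_pM2l _ (beta + 1)); last lra.
  rewrite mulrCA; apply: le_trans (ler_wpM2l (ltW r0) zD) _; lra.
have u0 : 0 <= ln z / ln p%:R by rewrite divr_ge0 ?ltW.
have u2 : ln z / ln p%:R <= (9 / 7) ^+ k.
  rewrite ler_pdivrMr //.
  have -> : (9 / 7) ^+ k = ((7 / 9) ^+ k)^-1 :> R by rewrite -exprVn invf_div.
  by rewrite mulrC ler_pdivlMr // mulrC.
apply: le_trans (_ : ((9 / 7) ^+ k) ^+ 5 <= _).
  by rewrite lerXn2r ?nnegrE // exprn_ge0 //; lra.
rewrite exprAC.
apply: le_trans (_ : (2 ^+ 2) ^+ k <= _).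
  by rewrite lerXn2r ?nnegrE ?exprn_ge0 //; lra.
rewrite -exprM ler_weXn2l ?ler1n //.
(* 2k <= size t + 1, as k is half of size t + 1 rounded down. *)
rewrite mul2n /k; move: (size t) => l.
by rewrite uphalfE -{2}(odd_double_half l.+1) leq_addl.
Qed.

Lemma beta_weight1 (R : realType) (b : bool) (beta D : R) : beta_weight b beta D 1 = 1.
Proof. by []. Qed.

(** Passing from m to pm adds only the condition at p. If an earlier one fails, both weights vanish;
    if the new one holds or is not tested, mu(pm) = - mu(m) cancels; otherwise only mu(m) remains,
    and the failure at p makes the right side at least 1. *)
Lemma beta_weight_primeM_lt (R : realType) (b : bool) (beta D z : R) (p m : nat) :
  8 <= beta -> 0 < D -> 0 < ln z -> (beta + 1) * ln z <= ln D ->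
  prime p -> (0 < m)%N -> {in primes m, forall q, (p < q)%N && (q%:R < z)} -> p%:R < z ->
  `|beta_weight b beta D m + beta_weight b beta D (p * m)|
    <= 2 / (ln z / ln p%:R) ^+ 5 * 2 ^+ size (primes m).
Proof.
move=> b8 D0 lz0 zD pp m0 pm pz.
have pm' : {in primes m, forall q, (p < q)%N} by move=> q /pm/andP[].
have lp0 : 0 < ln (p%:R : R) by rewrite ln_gt0 // ltr1n prime_gt1.
have u0 : 0 < (ln z / ln p%:R) ^+ 5 by rewrite exprn_gt0 // divr_gt0.
have B0 : 0 <= 2 / (ln z / ln p%:R) ^+ 5 * 2 ^+ size (primes m).
  by rewrite mulr_ge0 ?exprn_ge0 // divr_ge0 // ltW.
rewrite /beta_weight /primes_decr !size_rev primes_primeM_lt //.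
rewrite -[beta_cond beta D m]/(seq_beta_cond beta D (primes m)).
have -> : beta_cond beta D (p * m) = seq_beta_cond beta D (p :: primes m).
  by apply/funext => k; rewrite /beta_cond /primes_decr primes_primeM_lt.
rewrite [size (p :: _)]/= all_seq_beta_cond_cons mobius_primeM_lt //.
case: ifP => [ct|_]; last by rewrite addr0 normr0.
case: ifP => [_|/negbT]; first by rewrite rmorphN /= subrr normr0.
rewrite andTb negb_imply => /andP[/eqP ot cp]; rewrite addr0.
apply: le_trans (norm_mobius_le1 R m) _.
rewrite mulrAC ler_pdivlMr // mul1r -exprS.
apply: (seq_beta_cond_failure (b := b) b8) zD _ _ _ ct ot cp => //.
- rewrite /= path_sortedE; last exact: ltn_trans.
  by rewrite sorted_primes andbT; apply/allP.
- exact: prime_gt1.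
- move=> q; rewrite inE => /orP[/eqP->|qm]; first by rewrite prime_gt0.
  by have /andP[_ ->] := pm q qm; move: qm; rewrite mem_primes => /andP[/prime_gt0->].
Qed.

(** Induction removing the smallest prime p: the first term of the recursion carries the bound for
    the other primes, and the second adds the summand of p. *)
Lemma sieve_form_beta_weight_le (R : realType) (b : bool) (beta D z : R) (s : seq nat) :
  8 <= beta -> 0 < D -> 0 < ln z -> (beta + 1) * ln z <= ln D ->
  sorted ltn s -> all prime s -> {in s, forall q, q%:R < z} ->
  sieve_form (beta_weight b beta D) (\prod_(p <- s) p)%N <=
    (1 + 4 * expR 85 * (\sum_(p <- s) ln p%:R / p%:R) / ln z) * \prod_(p <- s) (1 - p%:R^-1).
Proof.
move=> b8 D0 lz0 zD.
elim: s => [|p s IH] /=.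
  by move=> _ _ _; rewrite !big_nil sieve_form1 beta_weight1 mulr0 mul0r addr0 expr1n mulr1.
move=> pss /andP[pp sp] sz.
have ss := path_sorted pss.
have ps : {in s, forall q, (p < q)%N}.
  by apply/allP; move: pss; rewrite path_sortedE; [case/andP|exact: ltn_trans].
have sz' : {in s, forall q, q%:R < z} by move=> q qs; apply: sz; rewrite inE qs orbT.
have pz := sz p (mem_head _ _).
have N0 := prod_prime_seq_gt0 sp.
have {IH} := IH ss sp sz'.
rewrite big_cons sieve_form_primeM //; last first.
  apply/negP => pN; have : p \in primes (\prod_(q <- s) q)%N by rewrite mem_primes pp N0.
  by rewrite primes_prod_sorted // => /ps; rewrite ltnn.
have lp0 : 0 < ln (p%:R : R) by rewrite ln_gt0 // ltr1n prime_gt1.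
set u := ln z / ln p%:R.
have u0 : 0 < u by rewrite divr_gt0.
have H1 : sieve_form (fun m => beta_weight b beta D m + beta_weight b beta D (p * m))
    (\prod_(q <- s) q) <= (2 / u ^+ 5) ^+ 2 * \prod_(q <- s) (1 + 8 / q%:R).
  rewrite -sieve_form_exp_omega //; apply: le_sieve_form => // m mN.
  apply: beta_weight_primeM_lt => //; first exact: dvdn_gt0 mN.
  by move=> q /(primes_dvd_prod_sorted ss sp mN) qs; rewrite ps ?sz'.
(* Enlarging the left product by the factor of p lets the factor 1 - 1/p appear on the right, as the
   induction requires. *)
have H2 : \prod_(q <- s) (1 + 8 / q%:R) <= expR 85 * u ^+ 9 * \prod_(q <- p :: s) (1 - q%:R^-1).
  apply: le_trans (prod_primes_ratio_le (prime_gt1 pp) pz _ _).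
  - rewrite big_cons ler_peMl //; last by rewrite lerDl divr_ge0.
    by rewrite prodr_ge0 // => q _; rewrite addr_ge0 // divr_ge0.
  - by apply: (sorted_uniq ltn_trans ltnn).
  - move=> q qs; rewrite sz // andbT.
    move: qs; rewrite inE => /orP[/eqP->|qs]; first by rewrite pp leqnn.
    by rewrite (allP sp) // ltnW // ps.
have p2 : 2 <= p%:R :> R by rewrite ler_nat prime_gt1.
have p0 : 0 < p%:R :> R by lra.
have pi1 : p%:R^-1 <= 1 :> R by rewrite invf_le1; lra.
have pi0 : 0 < p%:R^-1 :> R by rewrite invr_gt0; lra.
rewrite !big_cons in H2 *.
set V := \prod_(q <- s) (1 - q%:R^-1) in H2 *; set S := \sum_(q <- s) _.
set Q := sieve_form (beta_weight b beta D) _ => H0.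
(* u^(-10) u^9 leaves 1/u = ln p / ln z. *)
have H3 : (2 / u ^+ 5) ^+ 2 * (expR 85 * u ^+ 9 * ((1 - p%:R^-1) * V)) =
   4 * expR 85 * ln p%:R / ln z * ((1 - p%:R^-1) * V).
  by rewrite /u; field; rewrite !gt_eqF.
have c0 : 0 <= (2 / u ^+ 5) ^+ 2 by rewrite exprn_ge0 // divr_ge0 // exprn_ge0 // ltW.
have H4 := le_trans H1 (ler_wpM2l c0 H2); rewrite H3 in H4.
apply: le_trans (lerD (ler_wpM2l _ H0) (ler_wpM2l (ltW pi0) H4)) _; first lra.
rewrite le_eqVlt; apply/orP; left; apply/eqP; field.
by rewrite !gt_eqF.
Qed.

Theorem mainTheorem1 (R : realType) (beta : R) (hbeta : 8 <= beta) :
  exists C : R, 0 < C /\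
    forall (z D : R) (PP : set nat) (lambda : nat -> R),
      2 <= z -> z <= powR D (beta + 1)^-1 ->
      (forall p : nat, PP p -> prime p) ->
      lambda = upper_beta_weight beta D \/ lambda = lower_beta_weight beta D ->
      let P := sieve_prod PP z in
      \sum_(d <- divisors P)
         (totient d)%:R
         * (\sum_(m <- divisors P | (d %| m)%N) lambda m / m%:R) ^+ 2
      <= C * \prod_(p <- primes P) (1 - p%:R^-1).
Proof.
have e0 := @expR_gt0 R 85.
(* 12 = 4 * 3: the 4 of the induction bound times the 3 in sum ln p / p <= 3 ln z. *)
exists (1 + 12 * expR 85); split; first lra.
move=> z D PP lambda z2 zD PPprime lamE; cbv zeta; set P := sieve_prod PP z.
have z0 : 0 < z by lra.
have lz0 : 0 < ln z by rewrite ln_gt0; lra.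
have lzD : (beta + 1) * ln z <= ln D.
  have : ln z <= ln (powR D (beta + 1)^-1) by rewrite ler_ln ?posrE ?(lt_le_trans z0).
  by rewrite ln_powR ler_pdivlMl //; lra.
have D0 : 0 < D.
  (* [ln] is 0 at nonpositive arguments, which would contradict (beta + 1) ln z <= ln D. *)
  rewrite ltNge; apply/negP => /ln0 lD; move: lzD; rewrite lD; nra.
pose s := [seq p <- index_iota 0 (Num.truncn z).+1 | (p \in PP) && (p%:R < z)].
have PE : P = (\prod_(p <- s) p)%N by rewrite big_filter.
have ss : sorted ltn s by rewrite sorted_filter ?iota_ltn_sorted //; exact: ltn_trans.
have sp : all prime s.
  by apply/allP => q; rewrite mem_filter => /andP[/andP[/set_mem/PPprime]].
have sz : {in s, forall q, q%:R < z} by move=> q; rewrite mem_filter => /andP[/andP[]].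
have [b ->] : exists b, lambda = beta_weight b beta D.
  case: lamE => ->; [exists true|exists false].
    exact: upper_beta_weightE.
  exact: lower_beta_weightE.
rewrite -[leLHS]/(sieve_form (beta_weight b beta D) P) PE primes_prod_sorted //.
apply: le_trans (sieve_form_beta_weight_le b hbeta D0 lz0 lzD ss sp sz) _.
apply: ler_wpM2r.
  rewrite big_seq prodr_ge0 // => q /(allP sp) pq.
  by rewrite subr_ge0 invf_le1 ?ltr0n ?prime_gt0 // ler1n prime_gt0.
rewrite lerD2l ler_pdivrMr //.
have : \sum_(q <- s) (ln q%:R / q%:R) <= 3 * ln z.
  apply: sum_primes_ln_div_seq_le => //; first exact: (sorted_uniq ltn_trans ltnn).
  by move=> q qs; rewrite (allP sp) ?sz.
move=> H; apply: le_trans (ler_wpM2l _ H) _; lra.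
Qed.
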